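(* Let $G$ be a Poly-$\mathbb{Z}$ group. Then $G$ is nilpotent if and only if $\mathcal{V}^1_1(G)\subseteq\{1\}$.
   Context: A group $G$ is Poly-$\mathbb{Z}$ (capital P) if it has a finite chain of subgroups $1=G_\ell\subseteq\dots\subseteq G_{i+1}\subseteq G_i\subseteq\dots\subseteq G_1=G$ with every $G_i$ normal in $G$ and $G_i/G_{i+1}\cong\mathbb{Z}$ for $1\le i<\ell$. For a finitely generated group $G$, let $\mathbb{T}_G=\operatorname{Hom}(G,\mathbb{C}^* )$, with trivial character $1$; for $\rho\in\mathbb{T}_G$, $\mathbb{C}_\rho$ is the $G$-module $\mathbb{C}$ with $G$ acting through $\rho$. $\mathcal{V}^1_1(G)=\{\rho\in\mathbb{T}_G\mid\dim_{\mathbb{C}}H^1(G,\mathbb{C}_\rho)\ge1\}$. *)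

(* Defs.v *)
From HB Require Import structures.
From mathcomp Require Import all_boot all_algebra.
From mathcomp Require Import boolp classical_sets functions reals.
From mathcomp Require Import complex.

Set Implicit Arguments.
Unset Strict Implicit.
Unset Printing Implicit Defensive.

Import GRing.Theory.

Local Open Scope classical_set_scope.

Section Groups.
Local Open Scope group_scope.
Variable G : groupType.
Implicit Types A B H : set G.

Definition is_subgroup H : Prop :=
  [/\ H 1, forall x y, H x -> H y -> H (x * y) & forall x, H x -> H x^-1].

Definition is_normal H : Prop :=
  is_subgroup H /\ forall x g, H x -> H (x ^ g).

Definition generated A : set G := smallest is_subgroup A.

Definition commutator_subgroup A B : set G :=
  generated [set [~ x, y] | x in A & y in B].

Fixpoint lower_central n : set G :=
  if n is n'.+1 then commutator_subgroup (lower_central n') setT else setT.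

Definition nilpotent_group : Prop := exists n, lower_central n = [set 1].

Definition set_mul A B : set G := [set x * y | x in A & y in B].

Definition quotient_cosets A B : set (set G) :=
  [set [set x * b | b in B] | x in A].

(* [A / B] is isomorphic to the additive group Z; meant for [B] a normal
   subgroup of [A]. The group [A / B] has the cosets [x B], [x] in [A], as
   elements and the setwise product as multiplication. *)
Definition quotient_isom_Z A B : Prop :=
  exists phi : set G -> int,
    set_bij (quotient_cosets A B) setT phi /\
    {in quotient_cosets A B &, forall X Y,
       phi (set_mul X Y) = (phi X + phi Y)%R}.

Definition Poly_Z : Prop :=
  exists (l : nat) (H : nat -> set G),
    [/\ 1 <= l, H 1%N = setT, H l = [set 1%g],
        forall i, 1 <= i <= l -> is_normal (H i) &
        forall i, 1 <= i < l ->
          H i.+1 `<=` H i /\ quotient_isom_Z (H i) (H i.+1)]%N.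

End Groups.

Local Open Scope ring_scope.

Section UnitGroup.
Variable K : fieldType.

Record funits := FUnits { funits_val : K; _ : funits_val != 0 }.

HB.instance Definition _ := [isSub for funits_val].
HB.instance Definition _ := [Choice of funits by <:].

Definition funits_one := FUnits (oner_neq0 K).

Fact funits_mul_subproof (x y : funits) : funits_val x * funits_val y != 0.
Proof. by rewrite mulf_neq0 ?(valP x) ?(valP y). Qed.
Definition funits_mul x y := FUnits (funits_mul_subproof x y).

Fact funits_inv_subproof (x : funits) : (funits_val x)^-1 != 0.
Proof. by rewrite invr_eq0 (valP x). Qed.
Definition funits_inv x := FUnits (funits_inv_subproof x).

Fact funits_mulA : associative funits_mul.
Proof. by move=> x y z; apply: val_inj; rewrite /= mulrA. Qed.
Fact funits_mul1x : left_id funits_one funits_mul.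
Proof. by move=> x; apply: val_inj; rewrite /= mul1r. Qed.
Fact funits_mulx1 : right_id funits_one funits_mul.
Proof. by move=> x; apply: val_inj; rewrite /= mulr1. Qed.
Fact funits_mulVx : left_inverse funits_one funits_inv funits_mul.
Proof. by move=> x; apply: val_inj; rewrite /= mulVf // (valP x). Qed.
Fact funits_mulxV : right_inverse funits_one funits_inv funits_mul.
Proof. by move=> x; apply: val_inj; rewrite /= mulfV // (valP x). Qed.

HB.instance Definition _ := isGroup.Build funits
  funits_mulA funits_mul1x funits_mulx1 funits_mulVx funits_mulxV.

End UnitGroup.

Section QuotMod.
Local Open Scope quotient_scope.
Variables (K : pzRingType) (V : lmodType K) (S : submodClosed V).

(* [submodClosed] does not inherit from [zmodClosed], which the quotient of a
   zmodule requires; this copy of [S] carries both structures. *)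
Definition submod_pred : V -> bool := fun v => v \in S.
Fact submod_pred_closed : subsemimod_closed submod_pred.
Proof.
split; first by split; [exact: (rpred0 S) | exact: (rpredD (S := S))].
exact: (rpredZ (s := S)).
Qed.
HB.instance Definition _ := GRing.isSubmodClosed.Build K V submod_pred
  submod_pred_closed.

Definition submod_zmod := GRing.ZmodClosed.clone V submod_pred _.

Local Notation VS := (Quotient.quot submod_zmod).
Definition quotmod : Type := VS.

HB.instance Definition _ := GRing.Zmodule.copy quotmod VS.

Definition quotmod_scale (a : K) (x : quotmod) : quotmod :=
  \pi_VS (a *: repr (x : VS)).

Fact quotmod_piZ (a : K) (v : V) :
  quotmod_scale a (\pi_VS v) = \pi_VS (a *: v).
Proof.
apply/eqP; rewrite -Quotient.idealrBE -scalerBr; apply: (rpredZ (s := S)).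
by have := Quotient.idealrBE submod_zmod (repr (\pi_VS v)) v; rewrite reprK eqxx.
Qed.

Fact quotmod_scaleA a b v :
  quotmod_scale a (quotmod_scale b v) = quotmod_scale (a * b) v.
Proof.
rewrite -[v](@reprK _ VS).
by rewrite !quotmod_piZ scalerA.
Qed.

Fact quotmod_scale1 : left_id 1 quotmod_scale.
Proof.
move=> v; rewrite -[v](@reprK _ VS).
by rewrite quotmod_piZ scale1r.
Qed.

Fact quotmod_scaleDr : right_distributive quotmod_scale +%R.
Proof.
move=> a u v; rewrite -[u](@reprK _ VS).
rewrite -[v](@reprK _ VS).
rewrite !quotmod_piZ -[LHS]/(quotmod_scale _ (_ + _ : VS)).
by rewrite -raddfD quotmod_piZ scalerDr raddfD.
Qed.

Fact quotmod_scaleDl v : {morph quotmod_scale^~ v : a b / a + b}.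
Proof.
move=> a b; rewrite -[v](@reprK _ VS).
by rewrite !quotmod_piZ scalerDl raddfD.
Qed.

HB.instance Definition _ := GRing.Zmodule_isLmodule.Build K quotmod
  quotmod_scaleA quotmod_scale1 quotmod_scaleDr quotmod_scaleDl.

End QuotMod.

(* [dim_K V >= n], for [V] possibly of infinite dimension. *)
Definition dim_ge (K : fieldType) (V : lmodType K) (n : nat) : Prop :=
  exists v : 'I_n -> V,
    forall c : 'I_n -> K, \sum_i c i *: v i = 0 -> forall i, c i = 0.

Record gmodule (K : fieldType) (G : groupType) := GModule {
  gmod_space :> lmodType K;
  gact : G -> {linear gmod_space -> gmod_space};
  gact1 : forall m, gact 1%g m = m;
  gactM : forall g h m, gact (g * h)%g m = gact g (gact h m)
}.

Section Cohomology.
Variables (K : fieldType) (G : groupType) (M : gmodule K G).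

Definition cocycle1 : (G -> M) -> bool :=
  fun f => `[< forall g h : G, f (g * h)%g = f g + gact M g (f h) >].

Fact cocycle1_closed : subsemimod_closed cocycle1.
Proof.
split; first split.
- apply/asboolP => g h.
  by change (0 = 0 + gact M g 0 :> M); rewrite linear0 addr0.
- move=> u v /asboolP hu /asboolP hv; apply/asboolP => g h.
  by rewrite !fctE hu hv linearD addrACA.
- move=> a u /asboolP hu; apply/asboolP => g h.
  by rewrite !fctE hu scalerDr linearZ.
Qed.
HB.instance Definition _ := GRing.isSubmodClosed.Build K (G -> M) cocycle1
  cocycle1_closed.

Record Z1 := MkZ1 { Z1val :> G -> M; _ : Z1val \in cocycle1 }.
HB.instance Definition _ := [isSub for Z1val].
HB.instance Definition _ := [Choice of Z1 by <:].
HB.instance Definition _ := [SubChoice_isSubLmodule of Z1 by <:].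

Definition coboundary1 : Z1 -> bool :=
  fun f => `[< exists m : M, forall g, f g = gact M g m - m >].

Fact coboundary1_closed : subsemimod_closed coboundary1.
Proof.
split; first split.
- apply/asboolP; exists 0 => g; rewrite linear0 subr0.
  by rewrite -[Z1val _]/(val (0 : Z1)) raddf0.
- move=> u v /asboolP[m hm] /asboolP[n hn]; apply/asboolP.
  exists (m + n) => g; rewrite linearD opprD addrACA -hm -hn.
  by rewrite -[Z1val (u + v)]/(val (u + v)) raddfD.
- move=> a u /asboolP[m hm]; apply/asboolP.
  exists (a *: m) => g; rewrite linearZ -scalerBr -hm.
  by rewrite -[Z1val (a *: u)]/(val (a *: u)) linearZ.
Qed.
HB.instance Definition _ := GRing.isSubmodClosed.Build K Z1 coboundary1
  coboundary1_closed.

Definition B1 : submodClosed Z1 :=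
  GRing.SubmodClosed.clone K Z1 coboundary1 _.

Definition cohomology1 : lmodType K := quotmod B1.

End Cohomology.

Section Characters.
Variables (K : fieldType) (G : groupType).

Definition character : Type := monoid.UMagmaMorphism.type G (funits K).

Definition trivial_fun : G -> funits K := fun=> 1%g.
Fact trivial_fun_monoid_morphism : monoid.monoid_morphism trivial_fun.
Proof. by split=> // x y; rewrite /trivial_fun mulg1. Qed.
HB.instance Definition _ := monoid.isUMagmaMorphism.Build G (funits K)
  trivial_fun trivial_fun_monoid_morphism.
Definition trivial_character : character := trivial_fun.

Variable rho : character.

Definition char_act (g : G) : K^o -> K^o := fun z => funits_val (rho g) *: z.
Fact char_act_linear g : linear (char_act g).
Proof. by move=> a u v; rewrite /char_act scalerDr !scalerA mulrC. Qed.
HB.instance Definition _ g := GRing.isLinear.Build K K^o K^o *:%R (char_act g)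
  (char_act_linear g).

Fact char_act1 m : char_act 1%g m = m.
Proof. by rewrite /char_act gmulf1 scale1r. Qed.
Fact char_actM g h m : char_act (g * h)%g m = char_act g (char_act h m).
Proof. by rewrite /char_act gmulfM scalerA. Qed.

Definition char_module : gmodule K G :=
  GModule (gact := fun g => char_act g) char_act1 char_actM.

End Characters.

(* The characteristic variety V^1_k of G, inside the character group T_G. *)
Definition charvar1 (K : fieldType) (G : groupType) (k : nat) :
    set (character K G) :=
  [set rho | dim_ge (cohomology1 (char_module rho)) k].

Arguments trivial_character : clear implicits.
Arguments charvar1 : clear implicits.

(* Main.v *)
(* If [rho t <> 1], a cocycle [f] for [rho] vanishing at [t] vanishes on the
   whole of a nilpotent group: going up a central series, [x t = t x [x, t]]
   forces [f x = rho t f x]. Since every cocycle can be made to vanish at [t] by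
   subtracting a coboundary, only the trivial character contributes.

   Conversely, let [G_i / G_(i+1)] be the first non-central factor of the chain.
   [G] acts on it by a nontrivial sign [rho], and the quotient map
   [alpha : G_i -> Z] extends to a cocycle on [G]: fix [t] with [rho t <> 1],
   start from [g |-> alpha (g t g^-1 t^-1) / (1 - rho t)] on the centralizer of
   [t] modulo [G_i], and pass repeatedly to the normalizer [N(T)] of the current
   domain [T] by [s |-> f (s t s^-1) / (1 - rho t)]. As [G / G_i] is nilpotent,
   the iterated normalizers reach [G]. The cocycle takes the value 1 at a point
   where [rho] is trivial, so it is not a coboundary. *)
From HB Require Import structures.
Require Import Defs.
From mathcomp Require Import all_boot all_order all_algebra ring.
From mathcomp Require Import boolp classical_sets reals complex.

Set Implicit Arguments.
Unset Strict Implicit.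
Unset Printing Implicit Defensive.

Import Order.TTheory GRing.Theory Num.Theory.

Local Open Scope classical_set_scope.

(** * Central chains and normalizers *)

Section GroupSets.
Local Open Scope group_scope.
Variable G : groupType.
Implicit Types A B T : set G.

(** Only the steps below [n] have to be central, so that centrality of a chain can be established
    one step at a time. *)
Definition central_chain (H : nat -> set G) (n : nat) : Prop :=
  forall i x g, (i < n)%N -> H i x -> H i.+1 [~ x, g].

(** Both conjugates are required: in an infinite group, an inclusion of a conjugate of [T] in [T]
    need not be an equality. *)
Definition normalizer T : set G :=
  [set s | forall x, T x -> T (s * x * s^-1) /\ T (s^-1 * x * s)].

Lemma generated_subgroup A : is_subgroup (generated A).
Proof.
split=> [B [[B1 _ _] _] //|x y Ax Ay B BA|x Ax B BA].
  by have [[_ BM _] _] := BA; apply: BM; [exact: Ax BA | exact: Ay BA].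
by have [[_ _ BV] _] := BA; apply: BV; exact: Ax.
Qed.

Lemma lower_central_subgroup n : is_subgroup (@lower_central G n).
Proof. by case: n => [|n] //; exact: generated_subgroup. Qed.

Lemma lower_central_chain n : central_chain (@lower_central G) n.
Proof.
move=> i x g _ Hx; apply: (sub_smallest (@subset_refl _ _)).
by exists x => //; exists g.
Qed.

Lemma lower_central_sub (H : nat -> set G) n :
  H 0%N = setT -> (forall i, (i <= n)%N -> is_subgroup (H i)) ->
  central_chain H n -> @lower_central G n `<=` H n.
Proof.
move=> H0; elim: n => [|n IHn] Hsub Hc; first by rewrite H0.
have /IHn sub_n : forall i, (i <= n)%N -> is_subgroup (H i).
  by move=> i le_in; apply: Hsub; exact: leqW.
have {}sub_n : @lower_central G n `<=` H n.
  by apply: sub_n => i x g lt_in; apply: Hc; exact: leqW.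
apply: smallest_sub; first exact: Hsub.
by move=> _ [x Lx [y _ <-]]; apply: Hc => //; exact: sub_n.
Qed.

Lemma normalizer_subgroup T : is_subgroup (normalizer T).
Proof.
split=> [x Tx|s u Ns Nu x Tx|s Ns x Tx]; first by rewrite !monoid.gnorm.
  have [Tx1 _] := Nu x Tx; have [_ Tx2] := Ns x Tx.
  have [Tx3 _] := Ns _ Tx1; have [_ Tx4] := Nu _ Tx2.
  by move: Tx3 Tx4; rewrite !monoid.gnorm.
by have [] := Ns x Tx; rewrite invgK.
Qed.

Lemma sub_normalizer T : is_subgroup T -> T `<=` normalizer T.
Proof.
move=> [_ TM TV] s Ts x Tx; have TsV := TV _ Ts.
by split; apply: (TM) => //; exact: TM.
Qed.

Lemma normal_conj A (g x : G) : is_normal A -> A x -> A (g * x * g^-1).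
Proof. by move=> [_ nA] /(nA _ g^-1); rewrite conjgE invgK mulgA. Qed.

(** Normalizers grow along the chain: [s^-1 x s = x [s, x]^-1], and the commutator lies in [H i.+1],
    hence in [T]. *)
Lemma central_chain_normalizer (H : nat -> set G) n i T :
  central_chain H n -> (i < n)%N -> is_subgroup (H i) -> is_subgroup T ->
  H i.+1 `<=` T -> H i `<=` normalizer T.
Proof.
move=> Hc lt_in [_ _ HV] [_ TM TV] HT.
have conjT s x : H i s -> T x -> T (s^-1 * x * s).
  move=> Hs Tx; have -> : s^-1 * x * s = x * [~ s, x]^-1.
    by rewrite commgEl conjgE !monoid.gnorm.
  by apply: TM => //; apply/TV/HT/Hc.
move=> s Hs x Tx; split; last exact: conjT.
by rewrite -{1}[s]invgK; apply: conjT => //; exact: HV.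
Qed.

End GroupSets.

(** * Cocycles with values in a character *)

Section Cocycles.
Local Open Scope ring_scope.
Variables (K : fieldType) (G : groupType) (rho : G -> K).
Hypothesis rhoM : forall g h, rho (g * h)%g = rho g * rho h.
Hypothesis rho1 : rho 1%g = 1.

Definition cocycle_on (T : set G) (f : G -> K) : Prop :=
  forall g h, T g -> T h -> f (g * h)%g = f g + rho g * f h.

Lemma cocycle_on1 T f : is_subgroup T -> cocycle_on T f -> f 1%g = 0.
Proof.
move=> [T1 _ _] fT; have := fT _ _ T1 T1.
by rewrite mulg1 rho1 mul1r -{1}[f 1%g]addr0 => /addrI.
Qed.

Lemma rhoV g : rho g * rho g^-1%g = 1.
Proof. by rewrite -rhoM mulgV. Qed.

Lemma rho_conj g h : rho (g * h * g^-1)%g = rho h.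
Proof. by rewrite !rhoM mulrAC rhoV mul1r. Qed.

Lemma cocycle_onV T f g :
  is_subgroup T -> cocycle_on T f -> T g -> rho g * f g^-1%g = - f g.
Proof.
move=> sT fT Tg; have [_ _ TV] := sT; apply: (addrI (f g)).
by rewrite -fT ?mulgV ?subrr ?(cocycle_on1 sT) //; exact: TV.
Qed.

(** The relative form serves both directions: [T] is the whole group when [G] is nilpotent, and the
    current domain when a cocycle is being extended. *)
Lemma cocycle_on_central_chain (H : nat -> set G) n T f t :
  is_subgroup T -> central_chain H n -> cocycle_on T f ->
  T t -> rho t != 1 -> f t = 0 ->
  (forall x, T x -> H n x -> f x = 0) -> forall x, T x -> H 0%N x -> f x = 0.
Proof.
move=> [T1 TM TV] + fT Tt rt ft0; elim: n => [//|n IHn] Hc f0.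
apply: IHn => [i x g lt_in|x Tx Hx]; first by apply: Hc; exact: leqW.
have TR : T [~ x, t]%g.
  have [TxV TtV] := (TV _ Tx, TV _ Tt).
  by rewrite commgEl conjgE; apply: (TM) => //; apply: (TM) => //; exact: TM.
have := fT _ _ Tx Tt; rewrite ft0 mulr0 addr0 commgC fT //; last exact: TM.
rewrite fT // ft0 add0r (f0 [~ x, t]%g) //; last exact: Hc.
rewrite mulr0 addr0 => /eqP; rewrite -subr_eq0 -{2}[f x]mul1r -mulrBl.
by rewrite mulf_eq0 subr_eq0 (negPf rt) => /eqP.
Qed.

(** * Extending an equivariant homomorphism on [H n] to a cocycle on [G] *)

Section Extension.
Variables (H : nat -> set G) (n : nat) (t : G) (alpha : G -> K).
Hypothesis H0 : H 0%N = setT.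
Hypothesis Hsub : forall i, (i <= n)%N -> is_subgroup (H i).
Hypothesis Hc : central_chain H n.
Hypothesis Hn : is_normal (H n).
Hypothesis rt : rho t != 1.
Hypothesis rhoH : forall x, H n x -> rho x = 1.
Hypothesis alphaM :
  forall x y, H n x -> H n y -> alpha (x * y)%g = alpha x + alpha y.
Hypothesis alphaJ :
  forall g x, H n x -> alpha (g * x * g^-1)%g = rho g * alpha x.

Let rt1 : 1 - rho t != 0.
Proof. by rewrite subr_eq0 eq_sym. Qed.

(** Requiring [f t = 0] removes the coboundary freedom: as [rho t] differs from 1, only the zero
    coboundary vanishes at [t]. *)
Record extends (T : set G) (f : G -> K) : Prop := Extends {
  extends_subgroup : is_subgroup T;
  extends_mem : T t;
  extends_sub : H n `<=` T;
  extends_cocycle : cocycle_on T f;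
  extends_t : f t = 0;
  extends_alpha : forall x, H n x -> f x = alpha x }.

(* The start is the centralizer of [t] modulo [H n]. *)
Lemma extends_centralizer :
  extends [set g | H n (g * t * g^-1 * t^-1)%g]
    (fun g => alpha (g * t * g^-1 * t^-1)%g / (1 - rho t)).
Proof.
have [[Hn1 HnM HnV] _] := Hn.
have HnJ g x : H n x -> H n (g * x * g^-1)%g by exact: normal_conj.
(* The map [g |-> g t g^-1 t^-1] is a crossed homomorphism up to the order of the factors, and
   [alpha] turns conjugation by [g] into multiplication by [rho g]. *)
have rM (g h : G) : (g * h * t * (g * h)^-1 * t^-1 =
    g * (h * t * h^-1 * t^-1) * g^-1 * (g * t * g^-1 * t^-1))%g.
  by rewrite !monoid.gnorm.
(* On [H n] this gives [alpha x - rho t * alpha x], whence the denominator [1 - rho t]. *)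
have rx (x : G) : (x * t * x^-1 * t^-1 = x * (t * x^-1 * t^-1))%g.
  by rewrite !monoid.gnorm.
have a1 : alpha 1%g = 0.
  by apply: (addrI (alpha 1%g)); rewrite -alphaM // mulg1 addr0.
split=> /=.
- split=> /= [|g h Hg Hh|g Hg]; first by rewrite !monoid.gnorm.
    by rewrite rM; apply: HnM => //; exact: HnJ.
  by have := HnJ g^-1%g _ (HnV _ Hg); rewrite !monoid.gnorm.
- by rewrite !monoid.gnorm.
- by move=> x Hx /=; rewrite rx; apply: HnM => //; apply: HnJ; exact: HnV.
- move=> g h /= Hg Hh; rewrite rM alphaM ?alphaJ //; last exact: HnJ.
  by rewrite mulrDl addrC mulrA.
- by rewrite !monoid.gnorm a1 mul0r.
- move=> x Hx; have HxV : H n x^-1%g by exact: HnV.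
  rewrite rx alphaM ?alphaJ //; last exact: HnJ.
  have /eqP : alpha x + alpha x^-1%g = 0 by rewrite -alphaM // mulgV.
  by rewrite addr_eq0 => /eqP ->; field.
Qed.

(* For [s] normalizing [T], the cocycle [x |-> f (s x s^-1) - rho s * f x] on
   [T] is the coboundary of [- F s], the two agreeing on [t] and on [H n]. *)
Lemma extends_normalizer T f :
  extends T f ->
  extends (normalizer T) (fun s => f (s * t * s^-1)%g / (1 - rho t)).
Proof.
move=> [sT Tt HT fT ft0 fa].
pose F s := f (s * t * s^-1)%g / (1 - rho t); rewrite -/F.
have [T1 TM TV] := sT.
have FE s x : normalizer T s -> T x ->
    f (s * x * s^-1)%g = rho s * f x + (1 - rho x) * F s.
  move=> Ns Tx; have TJ y : T y -> T (s * y * s^-1)%g by case/Ns.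
  pose d y := f (s * y * s^-1)%g - (rho s * f y + (1 - rho y) * F s).
  apply/eqP; rewrite -subr_eq0; apply/eqP; rewrite -/(d x).
  apply: (@cocycle_on_central_chain H n T d t) => //; last by rewrite H0.
  - move=> y z Ty Tz; rewrite /d.
    have -> : (s * (y * z) * s^-1 = (s * y * s^-1) * (s * z * s^-1))%g.
      by rewrite !monoid.gnorm.
    rewrite (fT _ _ (TJ _ Ty) (TJ _ Tz)) (fT _ _ Ty Tz) rho_conj rhoM.
    by ring.
  - rewrite /d /F ft0 mulr0 add0r mulrCA mulfV // mulr1 subrr //.
  - move=> y Ty Hy; rewrite /d fa; last exact: normal_conj.
    by rewrite alphaJ // fa // (rhoH Hy) subrr mul0r addr0 subrr.
(* [F] extends [f]: since [f t = 0], expanding gives [f (s t s^-1) = (1 - rho t) f s]. *)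
have FT s : T s -> F s = f s.
  move=> Ts; have TsV := TV _ Ts.
  rewrite /F fT ?(fT s t) //; last exact: TM.
  rewrite ft0 mulr0 addr0 rhoM mulrAC (cocycle_onV sT fT Ts) mulNr.
  by rewrite -{1}[f s]mulr1 -mulrBr mulfK.
split.
- exact: normalizer_subgroup.
- exact: sub_normalizer.
- by move=> x Hx; apply: sub_normalizer => //; exact: HT.
- move=> s u Ns Nu; rewrite {1}/F.
  have -> : (s * u * t * (s * u)^-1 = s * (u * t * u^-1) * s^-1)%g.
    by rewrite !monoid.gnorm.
  (* At [u t u^-1] the value of [rho] is [rho t] and that of [f] is [(1 - rho t) F u]; dividing by
     [1 - rho t] leaves the cocycle rule. *)
  rewrite FE //; last by case/Nu: Tt.
  by rewrite rho_conj /F; field.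
- by rewrite FT.
- by move=> x Hx; rewrite FT ?fa //; exact: HT.
Qed.

Lemma cocycle_extension :
  exists2 f, cocycle_on setT f & forall x, H n x -> f x = alpha x.
Proof.
(* After [k] passages to the normalizer the domain contains [H (n - k)], so [n] of them suffice. *)
have ext k : (k <= n)%N -> exists T f, extends T f /\ H (n - k)%N `<=` T.
  elim: k => [_|k IHk lt_kn].
    by do 2!eexists; rewrite subn0; split;
      [|apply: extends_sub]; exact: extends_centralizer.
  have [T [f [fT HT]]] := IHk (ltnW lt_kn).
  do 2!eexists; split; first exact: extends_normalizer fT.
  apply: (central_chain_normalizer Hc); rewrite ?ltn_subrL //.
  - by rewrite /= (leq_ltn_trans _ lt_kn).
  - by apply: Hsub; exact: leq_subr.
  - exact: extends_subgroup fT.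
  - by rewrite -subnSK // subSS // in HT *.
have [T [f [fT HT]]] := ext n (leqnn n).
have {HT} HT x : T x by apply: HT; rewrite subnn H0.
exists f => [g h _ _|]; last exact: extends_alpha fT.
exact: (extends_cocycle fT).
Qed.

End Extension.
End Cocycles.

(** * The characteristic variety in terms of cocycles; nilpotent groups *)

Section CharacteristicVariety.
Local Open Scope ring_scope.
Variables (K : fieldType) (G : groupType).

Lemma character_inj (rho sigma : character K G) :
  (forall g, rho g = sigma g) -> rho = sigma.
Proof.
case: rho => r [[r1] [rM]]; case: sigma => s [[s1] [sM]] /= /funext rs.
move: r1 rM s1 sM; rewrite rs => r1 rM s1 sM.
by rewrite (Prop_irrelevance r1 s1) (Prop_irrelevance rM sM).
Qed.

Lemma character_of_mul (r : G -> K) :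
  r 1%g = 1 -> (forall g h, r (g * h)%g = r g * r h) ->
  exists rho : character K G, forall g, funits_val (rho g) = r g.
Proof.
move=> r1 rM.
have r_neq0 g : r g != 0.
  apply/eqP => rg0; have := rM g g^-1%g.
  by rewrite mulgV r1 rg0 mul0r => /eqP; rewrite oner_eq0.
pose chi g : funits K := FUnits (r_neq0 g).
have chi_morph : monoid.monoid_morphism chi.
  by split=> [|g h]; apply: val_inj => /=; [exact: r1 | exact: rM].
pose chi_mixin := monoid.isUMagmaMorphism.Build G (funits K) chi chi_morph.
pose rho : character K G := HB.pack chi chi_mixin.
by exists rho.
Qed.

Section FixedCharacter.
Variable rho : character K G.
Local Notation M := (char_module rho).
Local Notation rhoK := (fun g => funits_val (rho g)).

Lemma char_val1 : rhoK 1%g = 1.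
Proof. by rewrite /= gmulf1. Qed.

Lemma char_valM g h : rhoK (g * h)%g = rhoK g * rhoK h.
Proof. by rewrite /= gmulfM. Qed.

Local Notation Q := (Quotient.quot (submod_zmod (B1 M))).

Lemma cohomology1_eq0 (f : Z1 M) :
  (\pi_Q f == 0 :> Q)%qT = (f \in @coboundary1 K G M).
Proof.
have := Quotient.idealrBE (submod_zmod (B1 M)) f 0.
by rewrite subr0 raddf0 => <-.
Qed.

(** Over a field, a single vector is free exactly when it is nonzero, and a class vanishes exactly
    when its representative is a coboundary. *)
Lemma charvar1P :
  charvar1 K G 1 rho <->
  exists2 f, cocycle_on rhoK setT f &
    ~ exists m, forall g, f g = rhoK g * m - m.
Proof.
split=> [[v free_v]|[f fT f_nb]].
  pose f : Z1 M := repr (v ord0 : Q).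
  have pif : \pi_Q%qT f = v ord0 by rewrite reprK.
  exists (Z1val f) => [g h _ _|[m fE]].
    by have /asboolP := valP f; apply.
  have /eqP : \pi_Q%qT f == 0.
    by rewrite cohomology1_eq0; apply/asboolP; exists m.
  rewrite pif => v0; suff /eqP : (1 : K) = 0 by rewrite oner_eq0.
  apply: (free_v (fun=> 1) _ ord0).
  by rewrite big_ord1 scale1r.
have fZ : f \in @cocycle1 K G M by apply/asboolP => g h; exact: fT.
pose F : Z1 M := MkZ1 fZ.
exists (fun=> \pi_Q%qT F) => c; rewrite big_ord1 => cF0 i; rewrite ord1.
apply: contra_notP f_nb => /eqP c0.
have /eqP : \pi_Q%qT (c ord0 *: F) = 0 :> Q by rewrite -[RHS]cF0 -quotmod_piZ.
rewrite cohomology1_eq0 => cFB.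
have /asboolP[m fE] : F \in B1 M.
  by rewrite -[F]scale1r -(mulVf c0) -scalerA; apply: (rpredZ (s := B1 M)).
by exists m.
Qed.

End FixedCharacter.

Lemma nilpotent_charvar1 :
  nilpotent_group G -> charvar1 K G 1 `<=` [set trivial_character K G].
Proof.
move=> [n Hn] rho /charvar1P[f fT f_nb]; apply: character_inj => t.
apply: contra_notP f_nb => /eqP rt.
have {}rt : funits_val (rho t) != 1 by [].
(* The solution of [rho t * m - m = f t], so that subtracting the coboundary of [m] kills the value
   at [t]. *)
exists (f t / (funits_val (rho t) - 1)) => g.
set m := f t / _.
have rt1 : funits_val (rho t) - 1 != 0 by rewrite subr_eq0.
pose d g := f g - (funits_val (rho g) * m - m).
have dT : cocycle_on (fun g => funits_val (rho g)) setT d.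
  by move=> x y Tx Ty; rewrite /d fT // char_valM; ring.
have sT : is_subgroup [set: G] by [].
apply/eqP; rewrite -subr_eq0 -/(d g); apply/eqP.
have dt : d t = 0 by rewrite /d /m; field.
have d0 := cocycle_on_central_chain sT
  (lower_central_chain (n := n)) dT (t := t) I rt dt.
apply: d0 => // x _.
by rewrite Hn => ->; exact: (cocycle_on1 (char_val1 rho) sT dT).
Qed.

End CharacteristicVariety.

(** * Infinite cyclic quotients and the action of [G] on them *)

Section InfiniteCyclicQuotient.
Local Open Scope ring_scope.
Variables (G : groupType) (A B : set G).
Hypothesis nA : is_normal A.
Hypothesis nB : is_normal B.

Let coset (x : G) : set G := [set (x * b)%g | b in B].

Let coset_refl x : coset x x.
Proof. by have [[B1 _ _] _] := nB; exists 1%g => //; rewrite mulg1. Qed.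

Let coset_mul x y : set_mul (coset x) (coset y) = coset (x * y)%g.
Proof.
have [[_ BM _] BJ] := nB; apply/seteqP; split.
  move=> _ [_ [b Bb <-]] [_ [c Bc <-]] <-; have Bby := BJ b y Bb.
  by exists (b ^ y * c)%g; [exact: BM | rewrite conjgE !monoid.gnorm].
move=> _ [b Bb <-]; exists x => //.
by exists (y * b)%g; [exists b | rewrite mulgA].
Qed.

Let coset_id x : B x -> coset x = coset 1%g.
Proof.
have [[_ BM BV] _] := nB => Bx; apply/seteqP; split => _ [b Bb <-].
  by exists (x * b)%g; [exact: BM | rewrite mul1g].
by exists (x^-1 * b)%g; [apply: BM => //; exact: BV | rewrite mulVKg mul1g].
Qed.

(** Evaluate [phi] on the coset of an element; injectivity of [phi] identifies the kernel. Nothing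
    is known of [phi] off the cosets of elements of [A], hence the restrictions to [A]. *)
Lemma quotient_isom_Z_hom :
  quotient_isom_Z A B -> exists alpha : G -> int,
    [/\ forall x y, A x -> A y -> alpha (x * y)%g = alpha x + alpha y,
        forall x, A x -> (alpha x = 0 <-> B x)
      & forall m, exists2 x, A x & alpha x = m].
Proof.
have [[A1 _ _] _] := nA; have [[B1 _ _] _] := nB.
move=> [phi [[_ phi_inj phi_surj] phiM]].
have Acoset x : A x -> coset x \in quotient_cosets A B.
  by move=> Ax; rewrite inE; exists x.
have alphaM x y :
    A x -> A y -> phi (coset (x * y)%g) = phi (coset x) + phi (coset y).
  by move=> Ax Ay; rewrite -coset_mul phiM //; exact: Acoset.
have alpha1 : phi (coset 1%g) = 0.
  by apply: (addrI (phi (coset 1%g))); rewrite -alphaM // mulg1 addr0.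
exists (phi \o coset); split=> //= [x Ax|m].
  split=> [phix0|/coset_id ->//].
  have -> : B = coset 1%g.
    apply/seteqP; split => [b Bb|_ [b Bb <-]]; last by rewrite mul1g.
    by exists b; rewrite ?mul1g.
  rewrite -(phi_inj _ _ (Acoset _ Ax) (Acoset _ A1)); first exact: coset_refl.
  by rewrite phix0 alpha1.
by have [//|_ [x Ax <-] <-] := phi_surj m; exists x.
Qed.

(* [G] acts on [A / B] through the automorphisms of Z, that is, through a
   multiplicative [eps] with values in Z. *)
Lemma quotient_isom_Z_action (alpha : G -> int) :
  (forall x y, A x -> A y -> alpha (x * y)%g = alpha x + alpha y) ->
  (forall x, A x -> (alpha x = 0 <-> B x)) ->
  (forall m, exists2 x, A x & alpha x = m) ->
  exists eps : G -> int,
    [/\ eps 1%g = 1, forall g h, eps (g * h)%g = eps g * eps h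
      & forall g x, A x -> alpha (g * x * g^-1)%g = eps g * alpha x].
Proof.
move=> alphaM alpha0 alpha_surj.
have [[A1 AM AV] _] := nA.
have AJ g x : A x -> A (g * x * g^-1)%g by exact: normal_conj.
have /choice[s sP] : forall m, exists x, A x /\ alpha x = m.
  by move=> m; have [x Ax xm] := alpha_surj m; exists x.
have As m : A (s m) by case: (sP m).
have as_ m : alpha (s m) = m by case: (sP m).
have alpha1 : alpha 1%g = 0.
  by apply: (addrI (alpha 1%g)); rewrite -alphaM // mulg1 addr0.
have alphaV x : A x -> alpha x^-1%g = - alpha x.
  move=> Ax; apply: (addrI (alpha x)); rewrite subrr -alphaM ?mulgV //.
  exact: AV.
(* Conjugation descends to [A / B]: elements with equal [alpha] differ by an element of [B], which
   is normal in [G]. *)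
have alphaJ g x y :
    A x -> A y -> alpha x = alpha y ->
    alpha (g * x * g^-1)%g = alpha (g * y * g^-1)%g.
  move=> Ax Ay xy; have AyV := AV _ Ay.
  have AxyV : A (x * y^-1)%g by exact: AM.
  have Bxy : B (x * y^-1)%g.
    by apply/alpha0; rewrite // alphaM ?alphaV // xy subrr.
  have Bg := normal_conj g nB Bxy.
  have -> : (g * x * g^-1 = (g * (x * y^-1) * g^-1) * (g * y * g^-1))%g.
    by rewrite !monoid.gnorm.
  rewrite alphaM; [|exact: AJ|exact: AJ].
  by have /alpha0 -> := Bg; [rewrite add0r|exact: AJ].
pose beta g m := alpha (g * s m * g^-1)%g.
have betaD g m p : beta g (m + p) = beta g m + beta g p.
  rewrite /beta -alphaM; [|exact: AJ|exact: AJ].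
  rewrite (alphaJ _ _ (s m * s p)%g); [|exact: As|exact: AM|].
    by rewrite !monoid.gnorm.
  by rewrite alphaM // !as_.
have beta0 g : beta g 0 = 0.
  by apply: (addrI (beta g 0)); rewrite -betaD !addr0.
(* An additive map from Z to Z is multiplication by its value at 1; this value is [eps g]. *)
have betaE g m : beta g m = beta g 1 * m.
  elim/int_ind: m => [|m IHm|m IHm]; first by rewrite beta0 mulr0.
    by rewrite intS betaD IHm mulrDr mulr1.
  apply: (addrI (beta g 1)); rewrite -betaD intS opprD addrA subrr add0r.
  by rewrite IHm; ring.
have epsE g x : A x -> alpha (g * x * g^-1)%g = beta g 1 * alpha x.
  by move=> Ax; rewrite -betaE; apply: alphaJ => //; rewrite as_.
exists (beta^~ 1); split=> // [|g h].
  by rewrite /beta mul1g invg1 mulg1.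
rewrite -[beta h 1]/(alpha (h * s 1%R * h^-1)%g) -epsE; last exact: AJ.
by rewrite /beta; congr alpha; rewrite !monoid.gnorm.
Qed.

End InfiniteCyclicQuotient.

(** * From a trivial characteristic variety to nilpotency *)

Section PolyZ.
Local Open Scope ring_scope.
Variables (K : numFieldType) (G : groupType).

Hypothesis charvar_trivial : charvar1 K G 1 `<=` [set trivial_character K G].

Lemma charvar1_central_step (H : nat -> set G) (n : nat) (B : set G) :
  H 0%N = setT -> (forall i, (i <= n)%N -> is_normal (H i)) ->
  central_chain H n -> is_normal B -> quotient_isom_Z (H n) B ->
  forall x g, H n x -> B [~ x, g]%g.
Proof.
move=> H0 Hnorm Hc nB /(quotient_isom_Z_hom (Hnorm n (leqnn n)) nB).
move=> [alpha [alphaM alpha0 alpha_surj]].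
have nH := Hnorm n (leqnn n); have [[H1 HM HV] _] := nH.
have [eps [eps1 epsM epsJ]] :=
  quotient_isom_Z_action nH nB alphaM alpha0 alpha_surj.
have [a Ha a1] := alpha_surj 1.
(* If the action is trivial, [alpha] agrees on [x] and [g^-1 x g], so [[x, g]] lies in its kernel
   [B]. *)
suff eps_trivial t : eps t = 1.
  move=> x g Hx; have HxV := HV _ Hx.
  have HxJ : H n (g^-1 * x * g)%g.
    by have := normal_conj g^-1%g nH Hx; rewrite invgK.
  have -> : [~ x, g]%g = (x^-1 * (g^-1 * x * g))%g.
    by rewrite commgEl conjgE !mulgA.
  apply/alpha0; first exact: HM.
  rewrite alphaM // -{2}[g]invgK epsJ // eps_trivial mul1r -alphaM // mulVg.
  by apply/alpha0 => //; have [[]] := nB.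
apply: contrapT => /eqP et.
pose r g : K := (eps g)%:~R.
have r1 : r 1%g = 1 by rewrite /r eps1.
have rM g h : r (g * h)%g = r g * r h by rewrite /r epsM intrM.
(* Characteristic zero keeps the integers [eps t] and 1 distinct in [K]. *)
have rt : r t != 1 by rewrite /r -[1]/(1%:~R) eqr_int.
have rH x : H n x -> r x = 1.
  (* [x] acts on [a] by an inner automorphism of [H n], where [alpha] is
     additive. *)
  move=> Hx; have HxV := HV _ Hx; have Hxa := HM _ _ Hx Ha.
  suff -> : r x = (alpha (x * a * x^-1)%g)%:~R.
    rewrite !alphaM // a1 addrAC -alphaM // mulgV.
    by rewrite ((alpha0 _ H1).2 _) ?add0r //; have [[]] := nB.
  by rewrite epsJ // a1 mulr1.
have [f fT fa] := @cocycle_extension K G r rM r1 H n t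
  (fun x => (alpha x)%:~R) H0 (fun i le_in => (Hnorm i le_in).1) Hc nH rt rH
  (fun x y Hx Hy => etrans (congr1 _ (alphaM x y Hx Hy)) (intrD _ _ _))
  (fun g x Hx => etrans (congr1 _ (epsJ g x Hx)) (intrM _ _ _)).
have [rho rhoE] := character_of_mul r1 rM.
have : charvar1 K G 1 rho.
  apply/charvar1P; exists f => [g h _ _|[m fE]].
    by rewrite rhoE; exact: fT.
  have := fE a; rewrite fa // a1 rhoE rH // mul1r subrr => /eqP.
  by rewrite oner_eq0.
move=> /charvar_trivial /= rho1; move: rt.
by rewrite -rhoE rho1 /= eqxx.
Qed.

Lemma charvar1_nilpotent : Poly_Z G -> nilpotent_group G.
Proof.
move=> [l [H [l1 H1 Hl Hnorm Hquot]]].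
case: l l1 Hl Hnorm Hquot => [//|n] _ Hn Hnorm Hquot.
(* The Poly-Z chain starts at index 1 and central chains at 0; with [l = n.+1], the trivial term is
   [H' n]. *)
pose H' i := H i.+1.
(* Induction replaces the choice of a first non-central factor: centrality of the first [k] steps is
   what the next step needs. *)
have Hc k : (k <= n)%N -> central_chain H' k.
  elim: k => [//|k IHk] lt_kn i x g; rewrite ltnS leq_eqVlt.
  move=> /predU1P[->|lt_ik]; last by apply: IHk => //; exact: ltnW.
  have [_ HZ] := Hquot k.+1 lt_kn.
  apply: (charvar1_central_step (H := H')) => //.
  - by move=> j le_jk; apply: Hnorm; rewrite /= ltnS (leq_trans le_jk) // ltnW.
  - by apply: IHk; exact: ltnW.
  - by apply: Hnorm.
exists n; apply/seteqP; split; last first.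
  by move=> _ ->; have [] := lower_central_subgroup G n.
rewrite -Hn; apply: (lower_central_sub (H := H')) => //; last exact: Hc.
by move=> i le_in; have [] := Hnorm i.+1 le_in.
Qed.

End PolyZ.

Theorem theorem2p10 (R : realType) (G : groupType) (hG : Poly_Z G) :
  nilpotent_group G <->
  charvar1 R[i] G 1 `<=` [set trivial_character R[i] G].
Proof.
split; first exact: nilpotent_charvar1.
by move=> charvar_trivial; apply: (charvar1_nilpotent charvar_trivial hG).
Qed.
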